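(* Let $R$ be an integral domain, let $\ast=\tilde{\ast}$ be a star operation on $R$ that is spectral and of finite type, and assume that each $\ast$-prime ideal of $R$ is contained in a unique $\ast$-maximal ideal (e.g., $R$ has $\ast$-dimension one). Then the following conditions are equivalent: (i) $R$ is Clifford $\ast$-regular; (ii) $R_M$ is Clifford regular for each $M\in \ast\text{-Max}(R)$ and $R$ has the $\ast$-finite character; (iii) $R_M$ is Clifford regular for each $M\in \ast\text{-Max}(R)$ and $R$ has the $\ast$-local $\ast$-invertibility property. Under any one of these conditions, $\tilde{\ast}=w$.
   Context: $R$ is an integral domain with field of fractions $K$. An ideal of $R$ means a nonzero fractional ideal (an integral ideal if contained in $R$); prime ideals are integral and nonzero. $\mathcal F(R)$ is the set of ideals, and $(J:I)=\{x\in K: xI\subseteq J\}$. A star operation on $R$ is a map $\mathcal F(R)\to\mathcal F(R)$, $I\mapsto I^\ast$, such that for all $0\ne a\in K$ and $I,J\in\mathcal F(R)$: $R^\ast=R$ and $(aI)^\ast=aI^\ast$; $I\subseteq I^\ast$, and $I\subseteq J$ implies $I^\ast\subseteq J^\ast$; $I^{\ast\ast}=I^\ast$. It is of finite type if $I^\ast=\bigcup\{J^\ast: J\subseteq I,\ J \text{ a finitely generated ideal}\}$ for all $I$. $I$ is a $\ast$-ideal if $I=I^\ast$; a $\ast$-prime is a prime ideal that is a $\ast$-ideal; a $\ast$-maximal ideal is a maximal element of the set of proper integral $\ast$-ideals; $\ast\text{-Max}(R)$ is the set of $\ast$-maximal ideals. For $\ast$ of finite type, $\tilde{\ast}$ is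 the star operation $I\mapsto\bigcap_{M\in\ast\text{-Max}(R)}IR_M$; one has $\ast=\tilde\ast$ exactly when $\ast$ is spectral (i.e. $I^\ast=\bigcap_{P\in\mathcal G}IR_P$ for some family $\mathcal G$ of pairwise incomparable primes with $R=\bigcap_{P\in\mathcal G}R_P$) and of finite type. $I^v=(R:(R:I))$, $I^t=\bigcup\{J^v: J\subseteq I \text{ a finitely generated ideal}\}$, and $w=\tilde t$. $R$ is Clifford $\ast$-regular if for every ideal $I$ of $R$ there is an ideal $J$ of $R$ with $I^\ast=(I^2J)^\ast$; Clifford regular means this for the identity operation ($I=I^2J$). $R$ has the $\ast$-finite character if each nonzero element of $R$ is contained in at most finitely many $\ast$-maximal ideals. $R$ has the $\ast$-local $\ast$-invertibility property if each ideal $I$ such that $I^\ast R_M$ is principal for all $M\in\ast\text{-Max}(R)$ is $\ast$-invertible, i.e. $(I(R:I))^\ast=R$. $R$ has $\ast$-dimension one if each $\ast$-prime ideal has height one. *)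

(* Defs.v *)
From HB Require Import structures.
From mathcomp Require Import all_boot all_order all_algebra.
From mathcomp Require Import boolp classical_sets functions cardinality.

Set Implicit Arguments.
Unset Strict Implicit.
Unset Printing Implicit Defensive.

Import GRing.Theory.
Local Open Scope ring_scope.
Local Open Scope classical_set_scope.

(* All notions are stated for a subset [D] of a field [K], which is meant to
   be a subring of [K] having [K] as its field of fractions.  They are used
   both for the image of a domain in its field of fractions and for the
   localizations of that image, which live in the same field. *)

Section Ideals.
Variables (K : fieldType) (D : set K).
Implicit Types (I J P M : set K) (x y : K).

Record ideal I : Prop := Ideal {
  ideal_add : forall x y, I x -> I y -> I (x + y);
  ideal_mul : forall r x, D r -> I x -> I (r * x);
  ideal_neq0 : exists2 x, I x & x != 0;
  ideal_denom : exists d, [/\ D d, d != 0 & forall x, I x -> D (d * x)] }.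

Definition integral_ideal I : Prop := ideal I /\ I `<=` D.

Definition prime_ideal P : Prop :=
  [/\ integral_ideal P, P <> D &
      forall x y, D x -> D y -> P (x * y) -> P x \/ P y].

Definition scale x I : set K := [set x * y | y in I].

Definition iprod I J : set K :=
  [set z | exists (n : nat) (a b : 'I_n -> K),
     [/\ forall i, I (a i), forall i, J (b i) & z = \sum_(i < n) a i * b i]].

Definition colon J I : set K := [set x | forall y, I y -> J (x * y)].

Definition span n (g : 'I_n -> K) : set K :=
  [set z | exists2 r : 'I_n -> K,
     forall i, D (r i) & z = \sum_(i < n) r i * g i].

Definition fg_ideal J : Prop :=
  ideal J /\ exists (n : nat) (g : 'I_n -> K), J = span g.

Definition principal I : Prop := exists2 x, x != 0 & I = scale x D.

(* The localization at [P] as a subset of [K]; intended for prime [P]. *)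
Definition loc P : set K := [set a / s | a in D & s in D `\` P].

Definition clifford_regular : Prop :=
  forall I, ideal I -> exists2 J, ideal J & I = iprod (iprod I I) J.

End Ideals.

(* A star operation is a map on ideals: here it is a map on all subsets of
   [K], of which only the values at ideals of [D] are ever constrained or
   used. *)
Section StarOperations.
Variables (K : fieldType) (D : set K) (star : set K -> set K).
Implicit Types (I J P M : set K).

Record star_operation : Prop := StarOperation {
  star_ideal_val : forall I, ideal D I -> ideal D (star I);
  star_unit : star D = D;
  star_scale : forall (a : K) I, a != 0 -> ideal D I ->
    star (scale a I) = scale a (star I);
  star_sub : forall I, ideal D I -> I `<=` star I;
  star_mono : forall I J, ideal D I -> ideal D J -> I `<=` J ->
    star I `<=` star J;
  star_idem : forall I, ideal D I -> star (star I) = star I }.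

Definition finite_type : Prop :=
  forall I, ideal D I ->
    star I = \bigcup_(J in [set J | fg_ideal D J /\ J `<=` I]) star J.

(* The intersection over an empty family is the whole field [K]. *)
Definition spectral : Prop :=
  exists G : set (set K),
    [/\ forall P, G P -> prime_ideal D P,
        forall P Q, G P -> G Q -> P `<=` Q -> P = Q,
        D = \bigcap_(P in G) loc D P &
        forall I, ideal D I -> star I = \bigcap_(P in G) iprod I (loc D P)].

Definition star_ideal I : Prop := ideal D I /\ I = star I.

Definition star_prime P : Prop := prime_ideal D P /\ star_ideal P.

Definition proper_integral_star_ideal I : Prop :=
  [/\ star_ideal I, I `<=` D & I <> D].

Definition star_Max : set (set K) :=
  [set M | proper_integral_star_ideal M /\
           forall I, proper_integral_star_ideal I -> M `<=` I -> I = M].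

Definition star_tilde I : set K := \bigcap_(M in star_Max) iprod I (loc D M).

Definition star_invertible I : Prop := star (iprod I (colon D I)) = D.

Definition clifford_star_regular : Prop :=
  forall I, ideal D I ->
    exists2 J, ideal D J & star I = star (iprod (iprod I I) J).

Definition star_finite_character : Prop :=
  forall x : K, D x -> x != 0 -> finite_set [set M | star_Max M /\ M x].

Definition star_local_star_invertibility : Prop :=
  forall I, ideal D I ->
    (forall M, star_Max M -> principal (loc D M) (iprod (star I) (loc D M))) ->
    star_invertible I.

End StarOperations.

Section TW.
Variables (K : fieldType) (D : set K).

Definition v_op (I : set K) : set K := colon D (colon D I).

Definition t_op (I : set K) : set K :=
  \bigcup_(J in [set J | fg_ideal D J /\ J `<=` I]) v_op J.

Definition w_op : set K -> set K := star_tilde D t_op.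

End TW.

Definition frac_image (R : idomainType) : set {fraction R} := range (@tofrac R).
Arguments frac_image R : clear implicits.

(* Main.v *)
(* (i) => (iii): if [I] is locally [x D_M] and [I* = (I I J)*], then [J] is
   locally [x^-1 D_M], so [I J] is locally trivial.  Ideals of [D_M] are
   extended from [D], hence [D_M] inherits Clifford regularity.

   (iii) => (ii): distinct star-maximal [M], [N] contain no common star-prime,
   so every nonzero [x] divides some [s t] with [s] outside [M] and [t] outside
   [N].  Hence [I = x D_M `&` D] is [x D_M] at [M] and trivial at the other
   star-maximal ideals; being locally principal it is star-invertible, and
   [x (D : I)] isolates [M] among the star-maximal ideals containing [x].
   Finite type, i.e. compactness, then leaves only finitely many of them.

   (ii) => (i): local solutions [J_M] of [I_M = I_M I_M J_M], equal to [D_M] for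
   all but finitely many [M], are glued into [J = \bigcap_M J_M]; the same
   separation property gives [J D_M = J_M].

   Under local Clifford regularity each star-maximal ideal is a t-ideal, by
   Nakayama, so [star_Max] is the same for [star] and for [t]. *)
Require Import Defs.
From HB Require Import structures.
From mathcomp Require Import all_boot all_order all_algebra.
From mathcomp Require Import boolp classical_sets functions cardinality.
From mathcomp Require Import ring generic_quotient.

Set Implicit Arguments.
Unset Strict Implicit.
Unset Printing Implicit Defensive.

Import GRing.Theory.
Local Open Scope ring_scope.
Local Open Scope classical_set_scope.

Local Notation "I ** J" := (iprod I J) (at level 40, left associativity).
(* [span] would otherwise be the one of [vector]. *)
Local Notation span := Defs.span.

(** * Products of subsets of a field *)

Section Products.
Variable K : fieldType.
Implicit Types (I J T : set K) (x y z : K).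

Lemma iprod_in I J x y : I x -> J y -> (I ** J) (x * y).
Proof.
move=> Ix Jy; exists 1%N, (fun=> x), (fun=> y); split=> //.
by rewrite big_ord1.
Qed.

Lemma iprod_add I J x y : (I ** J) x -> (I ** J) y -> (I ** J) (x + y).
Proof.
move=> [n [a [b [Ia Jb ->]]]] [m [c [d [Ic Jd ->]]]].
exists (n + m)%N.
exists (fun i : 'I_(n + m) => match fintype.split i with inl j => a j | inr j => c j end).
exists (fun i : 'I_(n + m) => match fintype.split i with inl j => b j | inr j => d j end).
split=> [i|i|]; [by case: fintype.split|by case: fintype.split|].
rewrite big_split_ord /=; congr (_ + _); apply: eq_bigr => i _.
  by rewrite (unsplitK (inl i)).
by rewrite (unsplitK (inr i)).
Qed.

Lemma iprod0 I J : (I ** J) 0.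
Proof.
exists 0%N, (fun=> 0), (fun=> 0); split; [by case|by case|].
by rewrite big_ord0.
Qed.

Lemma iprod_min I J T : T 0 -> (forall x y, T x -> T y -> T (x + y)) ->
  (forall x y, I x -> J y -> T (x * y)) -> I ** J `<=` T.
Proof.
move=> T0 TD TM _ [n [a [b [Ia Jb ->]]]].
by apply: (big_ind T) => // i _; apply: TM.
Qed.

Lemma iprodS I I' J J' : I `<=` I' -> J `<=` J' -> I ** J `<=` I' ** J'.
Proof.
move=> sI sJ; apply: iprod_min; [exact: iprod0|exact: iprod_add|].
by move=> x y /sI Ix /sJ Jy; apply: iprod_in.
Qed.

Lemma iprodC I J : I ** J = J ** I.
Proof.
by apply/seteqP; split; apply: iprod_min;
  [exact: iprod0|exact: iprod_add| |exact: iprod0|exact: iprod_add|];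
  move=> x y Hx Hy; rewrite mulrC; apply: iprod_in.
Qed.

Lemma iprodA I J T : I ** (J ** T) = I ** J ** T.
Proof.
have sub (A B C : set K) : A ** (B ** C) `<=` A ** B ** C.
  apply: iprod_min; [exact: iprod0|exact: iprod_add|] => x y Ax; move: y.
  suff : B ** C `<=` [set y | (A ** B ** C) (x * y)] by [].
  apply: iprod_min => /=.
  - by rewrite mulr0; apply: iprod0.
  - by move=> u v; rewrite mulrDr; apply: iprod_add.
  - by move=> u v Bu Cv; rewrite mulrA; apply: iprod_in => //; apply: iprod_in.
apply/seteqP; split; first exact: sub.
by rewrite (iprodC I J) (iprodC _ T) (iprodC I) (iprodC J T); apply: sub.
Qed.

Lemma iprodCA I J T : I ** J ** T = I ** T ** J.
Proof. by rewrite -!iprodA (iprodC J). Qed.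

Lemma scale_iprod a I J : scale a (I ** J) = scale a I ** J.
Proof.
apply/seteqP; split.
  move=> _ [_ [n [c [d [Ic Jd ->]]]] <-].
  exists n, (fun i => a * c i), d; split=> // [i|]; first by exists (c i).
  by rewrite mulr_sumr; apply: eq_bigr => i _; rewrite mulrA.
apply: iprod_min.
- by exists 0; [exact: iprod0|rewrite mulr0].
- by move=> _ _ [x Hx <-] [y Hy <-]; exists (x + y);
    [exact: iprod_add|rewrite mulrDr].
- by move=> _ y [x Ix <-] Jy; exists (x * y); [exact: iprod_in|rewrite mulrA].
Qed.

Lemma scaleM a b I : scale a (scale b I) = scale (a * b) I.
Proof.
apply/seteqP; split=> [_ [_ [y Iy <-] <-]|_ [y Iy <-]].
  by exists y => //; rewrite mulrA.
by exists (b * y); [exists y|rewrite mulrA].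
Qed.

Lemma scale1 I : scale 1 I = I.
Proof.
apply/seteqP; split=> [_ [y Iy <-]|y Iy]; first by rewrite mul1r.
by exists y => //; rewrite mul1r.
Qed.

Lemma scaleK a I : a != 0 -> scale a^-1 (scale a I) = I.
Proof. by move=> a0; rewrite scaleM mulVf // scale1. Qed.

End Products.

(** * Subrings of a field and their fractional ideals *)

Section Orders.
Variable K : fieldType.
Implicit Types (D I J P M : set K) (x y z : K).

(** The sum [I + D x]. *)
Definition adjoin D I x : set K :=
  [set z | exists y r, [/\ I y, D r & z = y + r * x]].

Record subring D : Prop := Subring {
  subring1 : D 1;
  subringB : forall x y, D x -> D y -> D (x - y);
  subringM : forall x y, D x -> D y -> D (x * y) }.

Variables (D : set K) (Dring : subring D).

Let D1 : D 1 := subring1 Dring.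
Let DB := subringB Dring.
Let DM := subringM Dring.

Lemma subring0 : D 0.
Proof. by rewrite -(subrr 1); apply: DB. Qed.

Lemma subringN x : D x -> D (- x).
Proof. by move=> Dx; rewrite -sub0r; apply: DB => //; apply: subring0. Qed.

Lemma subringD x y : D x -> D y -> D (x + y).
Proof. by move=> Dx Dy; rewrite -[y]opprK; apply/DB/subringN. Qed.

Lemma ideal0 I : ideal D I -> I 0.
Proof.
move=> HI; have [x Ix _] := ideal_neq0 HI.
by rewrite -(mul0r x); apply: (ideal_mul HI subring0 Ix).
Qed.

Lemma ideal_sum I n (F : 'I_n -> K) :
  ideal D I -> (forall i, I (F i)) -> I (\sum_(i < n) F i).
Proof.
move=> HI IF; apply: (big_ind I) => //; first exact: ideal0.
exact: (ideal_add HI).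
Qed.

Lemma idealT : ideal D D.
Proof.
split; [exact: subringD|exact: DM| |].
  by exists 1; rewrite ?oner_neq0.
by exists 1; split; rewrite ?oner_neq0 // => x Dx; rewrite mul1r.
Qed.

Lemma ideal_scale a I : a != 0 -> ideal D I ->
  (exists2 d, D d & d != 0 /\ D (d * a)) -> ideal D (scale a I).
Proof.
move=> a0 HI [e De [e0 Dea]]; split.
- by move=> _ _ [x Ix <-] [y Iy <-]; exists (x + y);
    [exact: ideal_add HI _ _ Ix Iy|rewrite mulrDr].
- by move=> r _ Dr [x Ix <-]; exists (r * x);
    [exact: ideal_mul HI _ _ Dr Ix|rewrite mulrCA].
- have [x Ix x0] := ideal_neq0 HI; exists (a * x); first by exists x.
  by rewrite mulf_neq0.
- have [d [Dd d0 HIs]] := ideal_denom HI; exists (d * e); split.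
  + exact: DM.
  + by rewrite mulf_neq0.
  + move=> _ [x Ix <-]; have -> : d * e * (a * x) = (e * a) * (d * x) by ring.
    by apply: DM => //; apply: HIs.
Qed.

Lemma ideal_iprod I J : ideal D I -> ideal D J -> ideal D (I ** J).
Proof.
move=> HI HJ; split.
- exact: iprod_add.
- move=> r x Dr; move: x.
  suff : I ** J `<=` [set x | (I ** J) (r * x)] by []; apply: iprod_min.
  + by rewrite /= mulr0; apply: iprod0.
  + by move=> x y /=; rewrite mulrDr; apply: iprod_add.
  + move=> x y Ix Jy /=; rewrite mulrA; apply: iprod_in => //.
    exact: (ideal_mul HI Dr Ix).
- have [x Ix x0] := ideal_neq0 HI; have [y Jy y0] := ideal_neq0 HJ.
  by exists (x * y); [exact: iprod_in|rewrite mulf_neq0].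
- have [d [Dd d0 Hd]] := ideal_denom HI.
  have [e [De e0 He]] := ideal_denom HJ.
  exists (d * e); split; [exact: DM|by rewrite mulf_neq0|].
  suff : I ** J `<=` [set x | D (d * e * x)] by []; apply: iprod_min.
  + by rewrite /= mulr0; apply: subring0.
  + by move=> x y /=; rewrite mulrDr; apply: subringD.
  + move=> x y Ix Jy /=; have -> : d * e * (x * y) = d * x * (e * y) by ring.
    by apply: DM; [exact: Hd|exact: He].
Qed.

Lemma iprod_idr I : ideal D I -> I ** D = I.
Proof.
move=> HI; apply/seteqP; split=> [|x Ix].
  apply: iprod_min; [exact: ideal0|exact: ideal_add HI|].
  by move=> x y Ix Dy; rewrite mulrC; apply: (ideal_mul HI Dy Ix).
by rewrite -(mulr1 x); apply: iprod_in.
Qed.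

Lemma ideal_colon I : ideal D I -> ideal D (colon D I).
Proof.
move=> HI; split.
- by move=> x y Hx Hy z Iz; rewrite mulrDl; apply: subringD; [exact: Hx|exact: Hy].
- by move=> r x Dr Hx z Iz; rewrite -mulrA; apply: DM => //; apply: Hx.
- by have [d [Dd d0 Hd]] := ideal_denom HI; exists d.
- have [x Ix x0] := ideal_neq0 HI; have [d [Dd d0 Hd]] := ideal_denom HI.
  exists (d * x); split; [exact: Hd|by rewrite mulf_neq0|] => y Hy.
  by rewrite -mulrA; apply: DM => //; rewrite mulrC; apply: Hy.
Qed.

Lemma ideal_adjoin I x : ideal D I -> (exists2 d, D d & d != 0 /\ D (d * x)) ->
  ideal D (adjoin D I x).
Proof.
move=> HI [e De [e0 Dex]]; split.
- move=> _ _ [y [r [Iy Dr ->]]] [y' [r' [Iy' Dr' ->]]].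
  exists (y + y'), (r + r'); split; last by ring.
    exact: (ideal_add HI Iy Iy').
  exact: subringD.
- move=> s _ Ds [y [r [Iy Dr ->]]]; exists (s * y), (s * r).
  by split; [exact: ideal_mul HI _ _ Ds Iy|exact: DM|ring].
- have [y Iy y0] := ideal_neq0 HI; exists y => //; exists y, 0.
  by split=> //; [exact: subring0|rewrite mul0r addr0].
- have [d [Dd d0 Hd]] := ideal_denom HI.
  exists (d * e); split; [exact: DM|by rewrite mulf_neq0|].
  move=> _ [y [r [Iy Dr ->]]].
  have -> : d * e * (y + r * x) = e * (d * y) + d * r * (e * x) by ring.
  apply: subringD; first by apply: DM => //; apply: Hd.
  by apply: DM => //; apply: DM.
Qed.

Lemma mem_adjoinl I x : I `<=` adjoin D I x.
Proof.
by move=> y Iy; exists y, 0; split=> //; [exact: subring0|rewrite mul0r addr0].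
Qed.

Lemma mem_adjoinr I x : ideal D I -> adjoin D I x x.
Proof.
by move=> HI; exists 0, 1; split=> //; [exact: ideal0|rewrite mul1r add0r].
Qed.

(** Local witnesses are multiplied together: each condition [L N] survives multiplication by [D], so
    the product of finitely many witnesses meets all of them. With [S] the nonzero elements of [D]
    or the complement of a prime, this yields common denominators. *)
Lemma finite_simultaneous (T : Type) (F : set T) (S : set K) (L : T -> set K) :
  finite_set F -> S 1 -> (forall x y, S x -> S y -> S (x * y)) -> S `<=` D ->
  (forall N r x, F N -> D r -> L N x -> L N (r * x)) ->
  (forall N, F N -> exists2 s, S s & L N s) ->
  exists2 s, S s & forall N, F N -> L N s.
Proof.
elim/Pchoice: T => T in F L *.
move=> /finite_seqP[s ->] S1 SM SD; elim: s => [|N s IH] LM HL.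
  by exists 1.
have [|M MN|u Su Hu] := IH.
- by move=> M r x Ms; apply: LM; rewrite /= inE Ms orbT.
- by apply: HL; rewrite /= inE MN orbT.
have [v Sv Hv] := HL N (mem_head _ _).
exists (v * u); first exact: SM.
move=> M /=; rewrite inE => /orP[/eqP ->|Ms].
  by rewrite mulrC; apply: LM (mem_head _ _) (SD _ Su) Hv.
by apply: LM (SD _ Sv) (Hu M Ms); rewrite /= inE Ms orbT.
Qed.

End Orders.

(** * Localization at a prime ideal *)

Section Localization.
Variables (K : fieldType) (D : set K).
Hypothesis Dring : subring D.
Variable P : set K.
Hypothesis Pprime : prime_ideal D P.
Implicit Types (I J : set K) (x y z s : K).

Let DB := subringB Dring.
Let DM := subringM Dring.

Lemma prime_idealI : ideal D P.
Proof. by case: Pprime => -[]. Qed.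

Lemma prime_sub : P `<=` D.
Proof. by case: Pprime => -[]. Qed.

Lemma prime0 : P 0.
Proof. exact: (ideal0 Dring prime_idealI). Qed.

Lemma prime_not1 : ~ P 1.
Proof.
move=> P1; case: Pprime => _ PD _; apply: PD; apply/seteqP; split.
  exact: prime_sub.
move=> x Dx; rewrite -(mulr1 x).
exact: (ideal_mul prime_idealI Dx P1).
Qed.

Lemma prime_compl1 : (D `\` P) 1.
Proof. by split; [exact: subring1|exact: prime_not1]. Qed.

Lemma prime_complM x y : (D `\` P) x -> (D `\` P) y -> (D `\` P) (x * y).
Proof.
move=> [Dx Px] [Dy Py]; split; first exact: DM.
by case: Pprime => _ _ PM /(PM _ _ Dx Dy) [].
Qed.

Lemma prime_compl_neq0 s : (D `\` P) s -> s != 0.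
Proof. by move=> [_ Ps]; apply/eqP => s0; apply: Ps; rewrite s0; exact: prime0. Qed.

Lemma locP z : loc D P z <-> exists2 s, (D `\` P) s & D (s * z).
Proof.
split=> [[a Da [s Ss <-]]|[s Ss Dsz]].
  by exists s; rewrite // mulrCA divff ?mulr1 // prime_compl_neq0.
exists (s * z) => //; exists s => //.
by rewrite mulrAC divff ?mul1r // prime_compl_neq0.
Qed.

Lemma sub_loc : D `<=` loc D P.
Proof.
by move=> x Dx; apply/locP; exists 1; [exact: prime_compl1|rewrite mul1r].
Qed.

Lemma loc_inv s : (D `\` P) s -> loc D P s^-1.
Proof.
move=> Ss; apply/locP; exists s => //.
by rewrite divff ?prime_compl_neq0 //; apply: subring1.
Qed.

Lemma loc_subring : subring (loc D P).
Proof.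
split; first by apply: sub_loc; apply: subring1.
- move=> x y /locP[s Ss Dsx] /locP[t St Dty].
  apply/locP; exists (s * t); first exact: prime_complM.
  have -> : s * t * (x - y) = t * (s * x) - s * (t * y) by ring.
  by apply: DB; apply: DM => //; [case: St|case: Ss].
- move=> x y /locP[s Ss Dsx] /locP[t St Dty].
  apply/locP; exists (s * t); first exact: prime_complM.
  have -> : s * t * (x * y) = (s * x) * (t * y) by ring.
  exact: DM.
Qed.

(** The finitely many fractions occurring in an element of the extension have a common
    denominator. *)
Lemma ideal_locP I z : ideal D I ->
  (I ** loc D P) z <-> exists2 s, (D `\` P) s & I (s * z).
Proof.
move=> HI; split=> [|[s Ss Isz]]; last first.
  have -> : z = (s * z) * s^-1.
    by rewrite mulrAC divff ?mul1r // prime_compl_neq0.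
  by apply: iprod_in => //; apply: loc_inv.
move: z; suff : I ** loc D P `<=` [set z | exists2 s, (D `\` P) s & I (s * z)].
  by [].
apply: iprod_min => /=.
- exists 1; first exact: prime_compl1.
  by rewrite mulr0; apply: (ideal0 Dring HI).
- move=> x y [s Ss Isx] [t St Ity]; exists (s * t); first exact: prime_complM.
  have -> : s * t * (x + y) = t * (s * x) + s * (t * y) by ring.
  apply: (ideal_add HI _ _).
    by apply: (ideal_mul HI _ Isx); case: St.
  by apply: (ideal_mul HI _ Ity); case: Ss.
- move=> x y Ix /locP[s Ss Dsy]; exists s => //.
  by rewrite mulrCA mulrC; apply: (ideal_mul HI Dsy Ix).
Qed.

Lemma iprod_loc_loc : loc D P ** loc D P = loc D P.
Proof. exact: (iprod_idr loc_subring (idealT loc_subring)). Qed.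

Lemma iprod_locT : D ** loc D P = loc D P.
Proof.
apply/seteqP; split=> z.
  move/(ideal_locP _ (idealT Dring)) => [s Ss Dsz].
  by apply/locP; exists s.
move/locP => [s Ss Dsz].
by apply/(ideal_locP _ (idealT Dring)); exists s.
Qed.

Lemma iprod_locM I J : I ** J ** loc D P = (I ** loc D P) ** (J ** loc D P).
Proof.
by rewrite iprodA (iprodCA I (loc D P) J) -(iprodA _ (loc D P)) iprod_loc_loc.
Qed.

Lemma ideal_loc I : ideal D I -> ideal (loc D P) (I ** loc D P).
Proof.
move=> HI; split.
- exact: iprod_add.
- move=> r x Lr Hx; rewrite -iprod_loc_loc iprodA mulrC.
  exact: iprod_in.
- have [x Ix x0] := ideal_neq0 HI; exists x => //.
  by rewrite -(mulr1 x); apply: iprod_in => //; apply: (subring1 loc_subring).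
- have [d [Dd d0 Hd]] := ideal_denom HI.
  exists d; split=> // [|x]; first exact: sub_loc.
  move=> /(ideal_locP _ HI)[s Ss Isx]; apply/locP; exists s => //.
  by rewrite mulrCA; apply: Hd.
Qed.

Lemma ideal_loc_denom I : ideal (loc D P) I ->
  exists2 d, D d & d != 0 /\ forall x, I x -> loc D P (d * x).
Proof.
move=> HI; have [d [/locP[s Ss Dsd] d0 Hd]] := ideal_denom HI.
exists (s * d) => //; split; first by rewrite mulf_neq0 // prime_compl_neq0.
move=> x Ix; rewrite -mulrA; apply: (subringM loc_subring _ (Hd _ Ix)).
by apply: sub_loc; case: Ss.
Qed.

(** Elements of [D] outside [P] are units of the localization, so any [z] in [I] is recovered from a
    multiple [s z] lying in the contraction. *)
Lemma ideal_contraction I : ideal (loc D P) I -> I `<=` loc D P ->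
  ideal D (I `&` D) /\ (I `&` D) ** loc D P = I.
Proof.
move=> HI IL.
have HID : ideal D (I `&` D).
  split.
  - move=> x y [Ix Dx] [Iy Dy]; split; first exact: (ideal_add HI Ix Iy).
    exact: subringD.
  - move=> r x Dr [Ix Dx]; split; last exact: DM.
    by apply: (ideal_mul HI _ Ix); apply: sub_loc.
  - have [x Ix x0] := ideal_neq0 HI; have /locP[s Ss Dsx] := IL _ Ix.
    exists (s * x); last by rewrite mulf_neq0 // prime_compl_neq0.
    split=> //; apply: (ideal_mul HI _ Ix); apply: sub_loc; by case: Ss.
  - by exists 1; split; [exact: subring1|exact: oner_neq0|move=> x []; rewrite mul1r].
split=> //; apply/seteqP; split=> z.
  move=> /(ideal_locP _ HID)[s Ss [Isz _]].
  have -> : z = s^-1 * (s * z) by rewrite mulKf // prime_compl_neq0.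
  by apply: (ideal_mul HI _ Isz); apply: loc_inv.
move=> Iz; apply/(ideal_locP _ HID); have /locP[s Ss Dsz] := IL _ Iz.
exists s => //; split=> //; apply: (ideal_mul HI _ Iz).
by apply: sub_loc; case: Ss.
Qed.

End Localization.

(** * Finitely generated ideals *)

Section Spans.
Variables (K : fieldType) (D : set K).
Hypothesis Dring : subring D.

Lemma span_gen n (g : 'I_n -> K) i : span D g (g i).
Proof.
exists (fun j => (j == i)%:R).
  by move=> j; case: (j == i); [exact: subring1|exact: (subring0 Dring)].
by rewrite (bigD1 i) //= eqxx mul1r big1 ?addr0 // => j /negPf ->; rewrite mul0r.
Qed.

Lemma span_min n (g : 'I_n -> K) I :
  ideal D I -> (forall i, I (g i)) -> span D g `<=` I.
Proof.
move=> HI gI _ [r Dr ->]; apply: (ideal_sum Dring HI) => i.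
exact: (ideal_mul HI (Dr i) (gI i)).
Qed.

Lemma span_ideal n (g : 'I_n -> K) I i : ideal D I -> (forall j, I (g j)) ->
  g i != 0 -> ideal D (span D g).
Proof.
move=> HI gI gi0; split.
- move=> _ _ [r Dr ->] [r' Dr' ->]; exists (fun i => r i + r' i).
    by move=> j; apply: subringD.
  by rewrite -big_split /=; apply: eq_bigr => j _; rewrite mulrDl.
- move=> s _ Ds [r Dr ->]; exists (fun i => s * r i).
    by move=> j; apply: (subringM Dring).
  by rewrite mulr_sumr; apply: eq_bigr => j _; rewrite mulrA.
- by exists (g i) => //; apply: span_gen.
- have [d [Dd d0 Hd]] := ideal_denom HI; exists d; split=> // x gx.
  exact: Hd (span_min HI gI gx).
Qed.

End Spans.

(** * Star-primes and star-maximal ideals *)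

Section StarPrimes.
Variables (K : fieldType) (D : set K).
Hypothesis Dring : subring D.
Hypothesis Dfrac : forall z : K, exists2 d, D d & d != 0 /\ D (d * z).
Variable star : set K -> set K.
Hypothesis Hstar : star_operation D star.
Hypothesis Hfin : finite_type D star.
Implicit Types (I J P Q S M : set K) (x y z : K).

(** Scaling commutes with [star], so [z I] inside [Q] gives [z (star I)] inside [star Q = Q]. The
    case [z = 0] is apart because [star_scale] covers only nonzero scalars. *)
Lemma star_ideal_mulr z I Q : ideal D I -> star_ideal D star Q ->
  (forall x, I x -> Q (z * x)) -> forall x, star I x -> Q (z * x).
Proof.
move=> HI [HQ QE] IQ x Ix.
have [->|z0] := eqVneq z 0; first by rewrite mul0r; apply: ideal0 Dring _ HQ.
have HzI : ideal D (scale z I) by apply: ideal_scale.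
rewrite QE; apply: (star_mono Hstar HzI HQ); first by move=> _ [y Iy <-]; exact: IQ.
by rewrite (star_scale Hstar) //; exists x.
Qed.

Lemma star_sub_unit I : ideal D I -> I `<=` D -> star I `<=` D.
Proof.
move=> HI ID; have := star_mono Hstar HI (idealT Dring) ID.
by rewrite (star_unit Hstar).
Qed.

(** One notion for two uses: [S = {1}] gives the proper integral star-ideals, while products of
    elements outside [M] with elements outside [N] lead to star-primes inside both [M] and [N]. *)
Definition star_avoiding S P :=
  [/\ star_ideal D star P, P `<=` D & forall x, P x -> ~ S x].

(** If [x] and [y] lie outside [P], maximality puts elements [s] and [t] of [S] in the closures of
    [P + D x] and [P + D y]. If moreover [x y] is in [P], the product of these closures lies in [P],
    and so does [s t], which is in [S]. *)
Lemma maximal_avoiding_prime S P : S 1 ->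
  (forall x y, S x -> S y -> S (x * y)) -> S `<=` D ->
  star_avoiding S P -> (forall Q, star_avoiding S Q -> P `<=` Q -> Q = P) ->
  prime_ideal D P.
Proof.
move=> S1 SM SD [[HP PE] PD PS] Pmax.
have PsP : star_ideal D star P by [].
have meet x : D x -> ~ P x -> exists2 s, S s & star (adjoin D P x) s.
  move=> Dx nPx; apply: contrapT => nS; apply: nPx.
  have HPx : ideal D (adjoin D P x) by apply: ideal_adjoin.
  have PxD : adjoin D P x `<=` D.
    move=> _ [y [r [Py Dr ->]]]; apply: subringD => //; first exact: PD.
    exact: subringM.
  rewrite -(Pmax (star (adjoin D P x))).
  - exact: (star_sub Hstar HPx (mem_adjoinr Dring x HP)).
  - split; [split| |].
    + exact: (star_ideal_val Hstar).
    + by rewrite (star_idem Hstar).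
    + exact: star_sub_unit.
    + by move=> s Hs Ss; apply: nS; exists s.
  - apply: subset_trans (star_sub Hstar HPx); exact: (mem_adjoinl Dring).
split=> //.
  by move=> PD1; apply: (PS 1) => //; rewrite PD1; apply: subring1.
move=> x y Dx Dy Pxy; apply: contrapT => /not_orP[nPx nPy].
have [s Ss sx] := meet x Dx nPx; have [t St ty] := meet y Dy nPy.
have HPx : ideal D (adjoin D P x) by apply: ideal_adjoin.
have HPy : ideal D (adjoin D P y) by apply: ideal_adjoin.
apply: (PS (s * t)); last exact: SM.
apply: (star_ideal_mulr HPy PsP _ ty) => _ [p [r [Pp Dr ->]]].
have Ds : D s by apply: SD.
rewrite mulrDr; apply: (ideal_add HP); first exact: (ideal_mul HP).
rewrite mulrCA; apply: (ideal_mul HP) => //; rewrite mulrC.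
apply: (star_ideal_mulr HPx PsP _ sx) => _ [q [u [Pq Du ->]]].
rewrite mulrDr; apply: (ideal_add HP); first exact: (ideal_mul HP).
by rewrite mulrCA; apply: (ideal_mul HP) => //; rewrite mulrC.
Qed.

(** By Zorn's lemma. The union of a chain is again a star-ideal because, by finite type, only its
    finitely generated subideals matter, and each of them lies in one member of the chain. *)
Lemma exists_maximal_avoiding S I : star_avoiding S I -> exists P,
  [/\ I `<=` P, star_avoiding S P &
      forall Q, star_avoiding S Q -> P `<=` Q -> Q = P].
Proof.
move=> HI; have [[[HIi IE] ID IS]] := (HI, HI).
pose good X := I `<=` X /\ star_avoiding S X.
have I0 : I 0 by exact: ideal0 Dring _ HIi.
have [F Fgood Ftot|P [[P0|[IP SP]] Pmax]] :=
    @Zorn_bigcup _ [set X | X = set0 \/ good X].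
- have gd X x : F X -> X x -> good X.
    by move=> FX Xx; case: (Fgood X FX) => // X0; rewrite X0 in Xx.
  have [[X0 FX0 gX0]|noX] := pselect (exists2 X, F X & good X); last first.
    left; apply/seteqP; split=> // x [X FX Xx]; apply: noX; exists X => //.
    exact: gd Xx.
  right; set U := \bigcup_(X in F) X.
  have UD : U `<=` D.
    by move=> x [X FX Xx]; case: (gd _ _ FX Xx) => _ [_ XD _]; apply: XD.
  have IU : I `<=` U by move=> x Ix; exists X0 => //; apply: gX0.1.
  have HU : ideal D U.
    split.
    - move=> x y [X FX Xx] [Y FY Yy].
      have [_ [[HX _] _ _]] := gd _ _ FX Xx; have [_ [[HY _] _ _]] := gd _ _ FY Yy.
      case: (Ftot _ _ FX FY) => XY.
        by exists Y => //; apply: (ideal_add HY) => //; apply: XY.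
      by exists X => //; apply: (ideal_add HX) => //; apply: XY.
    - move=> r x Dr [X FX Xx]; exists X => //.
      by have [_ [[HX _] _ _]] := gd _ _ FX Xx; apply: (ideal_mul HX).
    - by have [x Ix x0] := ideal_neq0 HIi; exists x => //; apply: IU.
    - exists 1; split; [exact: subring1|exact: oner_neq0|].
      by move=> x Ux; rewrite mul1r; apply: UD.
  split=> //; split=> //; last first.
    by move=> x [X FX Xx]; case: (gd _ _ FX Xx) => _ [_ _]; apply.
  split=> //; apply/seteqP; split; first exact: (star_sub Hstar).
  rewrite {1}Hfin // => x [J [[HJ [n [g Jg]]] JU] Jx].
  have [X FX [gX JX]] : exists2 X, F X & good X /\ forall i, X (g i).
    suff [X FX [gX JX]] : exists2 X, F X &
        good X /\ forall i, i \in enum 'I_n -> X (g i).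
      by exists X => //; split=> // i; apply: JX; rewrite mem_enum.
    elim: (enum _) => [|i s [X FX [gX JX]]]; first by exists X0.
    have [Y FY Yi] : U (g i) by apply: JU; rewrite Jg; apply: span_gen.
    case: (Ftot _ _ FX FY) => XY.
      exists Y => //; split; first exact: gd Yi.
      by move=> j; rewrite inE => /orP[/eqP ->//|/JX /XY].
    exists X => //; split=> // j; rewrite inE => /orP[/eqP ->|/JX//].
    exact: XY.
  exists X => //; have [_ [[HX ->] _ _]] := gX.
  apply: (star_mono Hstar HJ HX _ Jx); rewrite Jg.
  exact: span_min.
- exfalso; apply: (Pmax I); last by right; split.
  by rewrite P0; split=> // /(_ _ I0).
- exists P; split=> // Q SQ PQ; apply: contrapT => nPQ; apply: (Pmax Q).
    split=> // QP; apply: nPQ; exact/seteqP.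
  by right; split=> //; apply: subset_trans PQ.
Qed.

Lemma star_avoiding1 P :
  star_avoiding [set 1] P <-> proper_integral_star_ideal D star P.
Proof.
split=> [[SP PD P1]|[SP PD nPD]]; split=> //.
  by move=> PE; apply: (P1 1) => //; rewrite PE; apply: subring1.
move=> x Px x1; apply: nPD; apply/seteqP; split=> // y Dy.
by rewrite -(mulr1 y); apply: (ideal_mul SP.1) => //; rewrite -x1.
Qed.

Lemma star_Max_prime M : star_Max D star M -> prime_ideal D M.
Proof.
move=> [/star_avoiding1 HM Mmax]; apply: (@maximal_avoiding_prime [set 1]) => //.
- by move=> _ _ -> ->; rewrite mulr1.
- by move=> _ ->; apply: subring1.
- by move=> Q /star_avoiding1; apply: Mmax.
Qed.

Lemma star_Max_exists I : proper_integral_star_ideal D star I ->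
  exists2 M, star_Max D star M & I `<=` M.
Proof.
move=> /star_avoiding1/exists_maximal_avoiding[M [IM HM Mmax]].
exists M => //; split; first exact/star_avoiding1.
by move=> Q /star_avoiding1; apply: Mmax.
Qed.

Hypothesis unique_Max : forall P, star_prime D star P ->
  exists! M, star_Max D star M /\ P `<=` M.

(** The products [s t] form a multiplicative set. If [x D] avoided it, a maximal star-ideal above
    [x D] avoiding it would be a star-prime contained in both [M] and [N], against [unique_Max]. *)
Lemma star_Max_separated M N x : star_Max D star M -> star_Max D star N ->
  M <> N -> D x -> x != 0 ->
  exists s t r, [/\ (D `\` M) s, (D `\` N) t, D r & s * t = x * r].
Proof.
move=> HM HN MN Dx x0; apply: contrapT => nst; apply: MN.
have pM := star_Max_prime HM; have pN := star_Max_prime HN.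
pose S : set K := [set z | exists s t, [/\ (D `\` M) s, (D `\` N) t & z = s * t]].
have SM s : (D `\` M) s -> S s.
  by move=> Ms; exists s, 1; rewrite mulr1; split=> //; apply: prime_compl1.
have SN s : (D `\` N) s -> S s.
  by move=> Ns; exists 1, s; rewrite mul1r; split=> //; apply: prime_compl1.
have HxD : ideal D (scale x D) by apply: ideal_scale => //; exact: idealT.
have [|P [_ HP Pmax]] := @exists_maximal_avoiding S (scale x D).
  split.
  - split=> //; rewrite (star_scale Hstar) // ?(star_unit Hstar) //.
    exact: idealT.
  - by move=> _ [r Dr <-]; apply: subringM.
  - by move=> _ [r Dr <-] [s [t [Ms Nt st]]]; apply: nst; exists s, t, r.
have Pp : prime_ideal D P.
  apply: (maximal_avoiding_prime _ _ _ HP Pmax).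
  - by apply: SM; apply: prime_compl1.
  - move=> _ _ [s [t [Ms Nt ->]]] [s' [t' [Ms' Nt' ->]]].
    exists (s * s'), (t * t'); split; [exact: prime_complM|exact: prime_complM|ring].
  - by move=> _ [s [t [[Ds _] [Dt _] ->]]]; apply: subringM.
have [sP PD PS] := HP.
have PM : P `<=` M.
  move=> p Pp'; apply: contrapT => nMp; apply: (PS p) => //.
  by apply: SM; split=> //; apply: PD.
have PN : P `<=` N.
  move=> p Pp'; apply: contrapT => nNp; apply: (PS p) => //.
  by apply: SN; split=> //; apply: PD.
have [|L [_ Luniq]] := unique_Max (P := P); first by [].
by rewrite -(Luniq M) // -(Luniq N).
Qed.

End StarPrimes.

(** * Clifford star-regularity *)

Section StarRegularity.
Variables (K : fieldType) (D : set K).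
Hypothesis Dring : subring D.
Hypothesis Dfrac : forall z : K, exists2 d, D d & d != 0 /\ D (d * z).
Variable star : set K -> set K.
Hypothesis Hstar : star_operation D star.
Hypothesis Hfin : finite_type D star.
Hypothesis Htilde : forall I, ideal D I -> star I = star_tilde D star I.
Implicit Types (I J P Q S M N : set K) (x y z : K).

Let Mprime M (HM : star_Max D star M) : prime_ideal D M :=
  star_Max_prime Dring Dfrac Hstar HM.

(** By [Htilde], [star I] lies in each [I D_M], so closing adds nothing locally. *)
Lemma star_loc I M : ideal D I -> star_Max D star M ->
  star I ** loc D M = I ** loc D M.
Proof.
move=> HI HM; have pM := Mprime HM; apply/seteqP; split; last first.
  by apply: iprodS => //; apply: (star_sub Hstar).
move=> z /(ideal_locP Dring pM _ (star_ideal_val Hstar HI))[s Ss].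
rewrite Htilde // => /(_ M HM) /(ideal_locP Dring pM _ HI)[t St].
rewrite mulrA => Itsz; apply/(ideal_locP Dring pM _ HI).
by exists (t * s) => //; apply: prime_complM.
Qed.

Lemma star_eqP I J : ideal D I -> ideal D J -> star I = star J <->
  forall M, star_Max D star M -> I ** loc D M = J ** loc D M.
Proof.
move=> HI HJ; split=> [IJ M HM|IJ].
  by rewrite -(star_loc HI HM) IJ star_loc.
rewrite !Htilde //; apply: eq_bigcapr => M HM; exact: IJ.
Qed.

Section Clifford.
Hypothesis Hcliff : clifford_star_regular D star.

(** An ideal of [D_M] is scaled into [D_M] and contracted to [D]; the factorization found there is
    then localized. *)
Lemma clifford_star_regular_loc M : star_Max D star M ->
  clifford_regular (loc D M).
Proof.
move=> HM I HI; have pM := Mprime HM; have Lring := loc_subring Dring pM.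
have [d Dd [d0 Hd]] := ideal_loc_denom Dring pM HI.
have HdI : ideal (loc D M) (scale d I).
  apply: ideal_scale => //; exists 1; first exact: (subring1 Lring).
  by rewrite oner_neq0 mul1r; split=> //; apply: (sub_loc Dring pM).
have dIL : scale d I `<=` loc D M by move=> _ [x Ix <-]; apply: Hd.
have [HC CE] := ideal_contraction Dring pM HdI dIL.
have [J HJ CJ] := Hcliff HC.
have HCCJ := ideal_iprod Dring (ideal_iprod Dring HC HC) HJ.
have /(_ M HM) := (star_eqP HC HCCJ).1 CJ.
rewrite !(iprod_locM Dring pM) CE => dIE.
(* In [d I = (d I) (d I) J_M] one factor [d] cancels and the other is absorbed by the witness. *)
exists (scale d (J ** loc D M)).
  apply: ideal_scale => //; first exact: ideal_loc.
  exists 1; first exact: (subring1 Lring).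
  by rewrite oner_neq0 mul1r; split=> //; apply: (sub_loc Dring pM).
rewrite -[LHS](scaleK _ d0) {}dIE -!scale_iprod [_ ** scale d I]iprodC.
rewrite -!scale_iprod scaleK // [RHS]iprodC -scale_iprod.
by rewrite [J ** _ ** _]iprodC.
Qed.

(** At each [M], [x D_M = x^2 J D_M] cancels to [x J D_M = D_M], so [star (I J) = D]. Then [J] lies
    in [(D : I)], which makes [I] star-invertible. *)
Lemma clifford_star_local_invertibility : star_local_star_invertibility D star.
Proof.
move=> I HI HIp; have [J HJ IE] := Hcliff HI.
have HIJ := ideal_iprod Dring HI HJ.
have star1 : star (I ** J) = D.
  rewrite -(star_unit Hstar); apply/(star_eqP HIJ (idealT Dring)) => M HM.
  have pM := Mprime HM.
  have /(_ M HM) := (star_eqP HI (ideal_iprod Dring (ideal_iprod Dring HI HI) HJ)).1 IE.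
  rewrite (iprod_locT Dring pM) !(iprod_locM Dring pM).
  have [x x0] := HIp M HM; rewrite star_loc // => -> E.
  have Lring := loc_subring Dring pM.
  rewrite -[RHS](scaleK _ x0) [in RHS]E -!scale_iprod [loc D M ** scale x _]iprodC.
  by rewrite -!scale_iprod scaleK // iprod_loc_loc.
have HIC := ideal_iprod Dring HI (ideal_colon Dring HI).
apply/seteqP; split.
  apply: (star_sub_unit Dring Hstar HIC);
  apply: iprod_min; [exact: (subring0 Dring)|exact: (subringD Dring)|].
    by move=> x y Ix; rewrite mulrC; apply.
rewrite -[X in X `<=` _]star1; apply: (star_mono Hstar HIJ HIC).
apply: iprodS => // y Jy x Ix; rewrite -star1.
by apply: (star_sub Hstar HIJ); rewrite mulrC; apply: iprod_in.
Qed.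

End Clifford.

Hypothesis unique_Max : forall P, star_prime D star P ->
  exists! M, star_Max D star M /\ P `<=` M.

Let separated := star_Max_separated Dring Dfrac Hstar Hfin unique_Max.

(** * From local invertibility to the finite character *)

Section LocalInvertibility.
Variables (M : set K) (x : K).
Hypotheses (HM : star_Max D star M) (Dx : D x) (x0 : x != 0).

Let I := scale x (loc D M) `&` D.

Lemma contract_principal_ideal : ideal D I /\ I ** loc D M = scale x (loc D M).
Proof.
have pM := Mprime HM; have Lring := loc_subring Dring pM.
apply: ideal_contraction => //.
  apply: ideal_scale => //; first exact: idealT.
  exists 1; first exact: (subring1 Lring).
  by rewrite oner_neq0 mul1r; split=> //; apply: (sub_loc Dring pM).
by move=> _ [y Ly <-]; apply: (subringM Lring) => //; apply: (sub_loc Dring pM).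
Qed.

(** Separation gives [s t = x r] with [s] outside [M], so [t = x (r / s)] lies in [x D_M]. *)
Lemma contract_principal_comaximal N : star_Max D star N -> M <> N ->
  exists2 t, (D `\` N) t & I t.
Proof.
move=> HN MN; have pM := Mprime HM.
have [s [t [r [Ms Nt Dr st]]]] := separated HM HN MN Dx x0.
exists t => //; split; last by case: Nt.
exists (r / s); first by exists r => //; exists s.
by rewrite mulrA -st mulrAC divff ?mul1r // (prime_compl_neq0 Dring pM).
Qed.

Lemma contract_principal_loc N : star_Max D star N ->
  principal (loc D N) (I ** loc D N).
Proof.
move=> HN; have [HI IM] := contract_principal_ideal.
have [MN|MN] := pselect (M = N); first by rewrite -MN IM; exists x.
have pN := Mprime HN; have [t Nt It] := contract_principal_comaximal HN MN.
exists 1; rewrite ?oner_neq0 // scale1; apply/seteqP; split.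
  by rewrite -[X in _ `<=` X](iprod_locT Dring pN); apply: iprodS => // y [].
move=> y /(locP Dring pN)[s Ns Dsy]; apply/(ideal_locP Dring pN _ HI).
exists (t * s); first exact: prime_complM.
by rewrite -mulrA mulrC; apply: (ideal_mul HI).
Qed.

(* The witness generates locally at [M] the complementary ideal
   [x (D : I)], where [I] is the contraction of [x D_M]. *)
Lemma star_Max_isolated : star_local_star_invertibility D star -> exists r,
  [/\ D r, ~ M r & forall N, star_Max D star N -> N x -> N <> M -> N r].
Proof.
move=> Hinv; have [HI IM] := contract_principal_ideal.
have pM := Mprime HM.
have HIC := ideal_iprod Dring HI (ideal_colon Dring HI).
have star1 : star (I ** colon D I) 1.
  rewrite Hinv //; first exact: (subring1 Dring).
  by move=> N HN; rewrite star_loc //; apply: contract_principal_loc.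
move: star1; rewrite Htilde // => /(_ M HM)/(ideal_locP Dring pM _ HIC)[s [Ds Ms]].
rewrite mulr1 => -[n [a [b [Ia Cb sE]]]].
have [i nMi] : exists i, ~ M (a i * b i).
  apply/existsNP => Mab; apply: Ms; rewrite sE.
  by apply: (ideal_sum Dring (prime_idealI pM)).
have Ix : I x.
  split=> //; exists 1; rewrite ?mulr1 //.
  exact: (subring1 (loc_subring Dring pM)).
have [[_ [c Dc [u [Du Mu] <-]] aE] Dai] : scale x (loc D M) (a i) /\ D (a i).
  by case: (Ia i).
have u0 : u != 0 by apply: (prime_compl_neq0 Dring pM).
have Dbx : D (b i * x) by apply: Cb.
(* At [M]: [u (a_i b_i) = c (b_i x)] with [u] outside [M], so [b_i x] in [M] would put [a_i b_i] in
   [M]. At [N]: some [t] in [I] lies outside [N], and [(b_i x) t = (b_i t) x] is in [N]. *)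
exists (b i * x); split=> //.
- move=> Mr; apply: nMi; apply: contrapT => nMab.
  have nM : ~ M (u * (a i * b i)).
    have [] // : (D `\` M) (u * (a i * b i)).
    apply: (prime_complM Dring pM) => //; split=> //.
    by rewrite mulrC; apply: (Cb i _ (Ia i)).
  apply: nM; rewrite -aE.
  have -> : u * (x * (c / u) * b i) = c * (b i * x) * (u / u) by ring.
  by rewrite divff // mulr1; apply: (ideal_mul (prime_idealI pM)).
- move=> N HN Nx NM; have pN := Mprime HN.
  have [t [Dt Nt] It] : exists2 t, (D `\` N) t & I t.
    by apply: contract_principal_comaximal => // MN; apply: NM.
  have [_ _ /(_ _ _ Dbx Dt)[]//] := pN.
  have -> : b i * x * t = (b i * t) * x by ring.
  by apply: (ideal_mul (prime_idealI pN)) => //; apply: Cb.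
Qed.

End LocalInvertibility.

(** The closure of the ideal [A] below contains 1, hence so does that of a finitely generated [J]
    inside [A]. Every [M] in [X] omits a generator of [J], and each generator is omitted by only
    finitely many [M] in [X]. *)
Lemma star_local_invertibility_finite_character :
  star_local_star_invertibility D star -> star_finite_character D star.
Proof.
move=> Hinv x Dx x0.
pose X := [set M | star_Max D star M /\ M x].
(* An integral ideal lying in no element of [X], whose finitely generated
   subideals lie in all but finitely many of them. *)
pose A := [set r | D r /\ finite_set [set M | X M /\ ~ M r]].
have Mi M : X M -> ideal D M by case=> /Mprime/prime_idealI.
have AX M : X M -> exists2 r, A r & ~ M r.
  move=> [HM Mx]; have [r [Dr Mr Nr]] := star_Max_isolated HM Dx x0 Hinv.
  exists r => //; split=> //; apply: (@sub_finite_set _ _ [set M]) => //.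
  by move=> N [[HN Nx] nNr]; apply: contrapT => NM; apply: nNr; apply: Nr.
(* This forces any star-maximal ideal containing [A] into [X]. *)
have Ax : A x.
  split=> //; apply: (@sub_finite_set _ _ set0) => //.
  by move=> N [[_ Nx]].
have HA : ideal D A.
  split.
  - move=> r s [Dr Fr] [Ds Fs]; split; first exact: subringD.
    apply: (@sub_finite_set _ _
      ([set M | X M /\ ~ M r] `|` [set M | X M /\ ~ M s])).
      move=> N [XN nN]; apply: contrapT => /not_orP[nr ns]; apply: nN.
      have Nr : N r by apply: contrapT => h; apply: nr.
      have Ns : N s by apply: contrapT => h; apply: ns.
      exact: (ideal_add (Mi N XN)).
    by rewrite finite_setU.
  - move=> r s Dr [Ds Fs]; split; first exact: (subringM Dring).
    apply: sub_finite_set Fs => N [XN nN]; split=> // Ns; apply: nN.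
    exact: (ideal_mul (Mi N XN)).
  - by exists x.
  - exists 1; split; [exact: (subring1 Dring)|exact: oner_neq0|].
    by move=> y [Dy _]; rewrite mul1r.
have sAD : star A `<=` D by apply: (star_sub_unit Dring Hstar HA) => y [].
have sAi := star_ideal_val Hstar HA.
have sA1 : star A 1.
  apply: contrapT => nA1.
  have [|N HN AN] := star_Max_exists Dring Hstar Hfin (I := star A).
    split=> //; first by split=> //; rewrite (star_idem Hstar).
    by move=> sAE; apply: nA1; rewrite sAE; apply: (subring1 Dring).
  have AsubN := subset_trans (star_sub Hstar HA) AN.
  have [r /AsubN Nr []//] := AX N (conj HN (AsubN _ Ax)).
move: sA1; rewrite Hfin // => -[J [[HJ [n [g Jg]]] JA] J1].
have gA i : A (g i) by apply: JA; rewrite Jg; apply: span_gen.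
apply: (@sub_finite_set _ _ (\bigcup_(i in [set: 'I_n]) [set M | X M /\ ~ M (g i)])).
  move=> M XM; apply: contrapT => nU.
  have Mg i : M (g i) by apply: contrapT => h; apply: nU; exists i.
  have HMi := Mi M XM.
  have [[[[_ ME] _ _] _] _] := XM.
  apply: (prime_not1 (Mprime XM.1)); rewrite ME.
  by apply: (star_mono Hstar HJ HMi _ J1); rewrite Jg; apply: span_min.
apply: bigcup_finite; first exact: finite_finset.
by move=> i _; case: (gA i).
Qed.

(** The finite character leaves only finitely many conditions whenever the local solutions need a
    common denominator, a common nonzero element, or a multiplier bringing an element of one into
    all the others. *)
Lemma finite_character_clifford :
  (forall M, star_Max D star M -> clifford_regular (loc D M)) ->
  star_finite_character D star -> clifford_star_regular D star.
Proof.
move=> Hloc Hfc I HI.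
have [d0 [Dd0 d00 Hd0]] := ideal_denom HI; have [c Ic c0] := ideal_neq0 HI.
(* [y] lies in [I]; if it is outside [M], so is [d0], which carries [I] into [D]. Hence
   [I D_M = D_M], and [D_M] is a local solution at such [M]. *)
pose y := d0 * (d0 * c).
have Dy : D y by apply: (subringM Dring) => //; apply: Hd0.
have y0 : y != 0 by rewrite !mulf_neq0.
have Iy M : star_Max D star M -> ~ M y -> I ** loc D M = loc D M.
  move=> HM nMy; have pM := Mprime HM; apply/seteqP; split=> z.
    move=> /(ideal_locP Dring pM _ HI)[s [Ds Ms] Isz].
    apply/(locP Dring pM); exists (d0 * s); last by rewrite -mulrA; apply: Hd0.
    apply: (prime_complM Dring pM) => //; split=> // Md0; apply: nMy.
    by rewrite /y mulrC; apply: (ideal_mul (prime_idealI pM)) => //; apply: Hd0.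
  move=> /(locP Dring pM)[s [Ds Ms] Dsz]; apply/(ideal_locP Dring pM _ HI).
  exists (y * s); first exact: (prime_complM Dring pM).
  have -> : y * s * z = d0 * d0 * (s * z) * c by rewrite /y; ring.
  by apply: (ideal_mul HI) => //; apply: (subringM Dring) => //; apply: (subringM Dring).
(* Choice ranges over all sets; the value [D] at those that are not star-maximal is arbitrary. *)
have /choice[J HJ] : forall M, exists JM, star_Max D star M ->
    [/\ ideal (loc D M) JM,
        I ** loc D M = (I ** loc D M) ** (I ** loc D M) ** JM &
        ~ M y -> JM = loc D M].
  move=> M.
  have [HM|nHM] := pselect (star_Max D star M); last by exists D.
  have pM := Mprime HM.
  have [My|nMy] := pselect (M y).
    by have [JM HJM JE] := Hloc M HM _ (ideal_loc Dring pM HI); exists JM.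
  exists (loc D M) => _; split=> //; first exact: (idealT (loc_subring Dring pM)).
  by rewrite Iy // !(iprod_loc_loc Dring pM).
have HJi M (HM : star_Max D star M) : ideal (loc D M) (J M) by case: (HJ M HM).
have HJm M r z : star_Max D star M -> D r -> J M z -> J M (r * z).
  move=> HM Dr; apply: (ideal_mul (HJi M HM)).
  exact: (sub_loc Dring (Mprime HM)).
have [d [Dd d0'] Hd] : exists2 d, D d /\ d != 0 &
    forall M, star_Max D star M /\ M y -> forall z, J M z -> loc D M (d * z).
  apply: (finite_simultaneous (D := D)
    (L := fun M d => forall z, J M z -> loc D M (d * z))).
  - exact: Hfc.
  - by split; [exact: (subring1 Dring)|exact: oner_neq0].
  - by move=> u v [Du u0] [Dv v0]; split; [exact: (subringM Dring)|rewrite mulf_neq0].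
  - by move=> u [].
  - move=> M r u [HM _] Dr Hu z Jz; have pM := Mprime HM.
    rewrite -mulrA; apply: (subringM (loc_subring Dring pM)); last exact: Hu.
    exact: (sub_loc Dring pM).
  - move=> M [HM _].
    by have [d Dd [d0' Hd]] := ideal_loc_denom Dring (Mprime HM) (HJi M HM); exists d.
have {}Hd M z : star_Max D star M -> J M z -> loc D M (d * z).
  move=> HM Jz; have [My|nMy] := pselect (M y); first exact: Hd.
  have pM := Mprime HM; have [_ _ JE] := HJ M HM; move: Jz; rewrite JE // => Lz.
  by apply: (subringM (loc_subring Dring pM)) => //; apply: (sub_loc Dring pM).
(* Outside this finite set the local solution is [D_M] and [d] is a unit of [D_M]. *)
pose X := [set M | star_Max D star M /\ M (y * d)].
have Xfin : finite_set X by apply: Hfc; [exact: (subringM Dring)|rewrite mulf_neq0].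
have JX M : star_Max D star M -> ~ X M -> (D `\` M) d /\ J M = loc D M.
  move=> HM nX; have pM := Mprime HM; split.
    by split=> // Md; apply: nX; split=> //; apply: (ideal_mul (prime_idealI pM)).
  have [_ _] := HJ M HM; apply => My; apply: nX; split=> //.
  by rewrite mulrC; apply: (ideal_mul (prime_idealI pM)).
pose J0 := [set z | forall M, star_Max D star M -> J M z].
have DE z : (forall M, star_Max D star M -> loc D M z) -> D z.
  move=> Lz; rewrite -(star_unit Hstar) (Htilde (idealT Dring)) => M HM.
  by rewrite (iprod_locT Dring (Mprime HM)); apply: Lz.
have HJ0 : ideal D J0.
  split.
  - move=> u v Ju Jv M HM; apply: (ideal_add (HJi M HM)); [exact: Ju|exact: Jv].
  - by move=> r u Dr Ju M HM; apply: HJm => //; apply: Ju.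
  - have [u [Du u0] Hu] : exists2 u, D u /\ u != 0 & forall M, X M -> J M u.
      apply: (finite_simultaneous (D := D) Xfin).
      + by split; [exact: (subring1 Dring)|exact: oner_neq0].
      + by move=> u v [Du u0] [Dv v0]; split; [exact: (subringM Dring)|rewrite mulf_neq0].
      + by move=> u [].
      + by move=> M r u [HM _]; apply: HJm.
      + move=> M [HM _]; have [u Ju u0] := ideal_neq0 (HJi M HM).
        have [b Db [b0 Dbu]] := Dfrac u.
        by exists (b * u); [split=> //; rewrite mulf_neq0|exact: HJm].
    exists u => // M HM; have [XM|nXM] := pselect (X M); first exact: Hu.
    by have [_ ->] := JX M HM nXM; apply: (sub_loc Dring (Mprime HM)).
  - exists d; split=> // z Jz; apply: DE => M HM; apply: Hd => //; exact: Jz.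
have J0E M : star_Max D star M -> J0 ** loc D M = J M.
  move=> HM; have pM := Mprime HM; apply/seteqP; split=> z.
    move=> /(ideal_locP Dring pM _ HJ0)[s Ms /(_ M HM) Jsz].
    rewrite -(mulKf (prime_compl_neq0 Dring pM Ms) z).
    exact: (ideal_mul (HJi M HM) (loc_inv Dring pM Ms)).
  move=> Jz; apply/(ideal_locP Dring pM _ HJ0).
  (* For [N] other than [M], take a nonzero [e] in [J N] and a denominator [b] of [z / e].
     Separation applied to [b] gives [s t = b r] with [t] outside [N], so [s z] is a [D_N]-multiple
     of [e]. *)
  have [s Ms Hs] : exists2 s, (D `\` M) s & forall N, X N -> J N (s * z).
    apply: (finite_simultaneous (D := D) (L := fun N s => J N (s * z)) Xfin).
    - exact: (prime_compl1 Dring pM).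
    - by move=> u v; apply: (prime_complM Dring pM).
    - by move=> u [].
    - by move=> N r u [HN _] Dr Ju; rewrite -mulrA; apply: HJm.
    - move=> N [HN _]; have pN := Mprime HN.
      have [<-|MN] := pselect (M = N).
        by exists 1; [exact: (prime_compl1 Dring pM)|rewrite mul1r].
      have [e Je e0] := ideal_neq0 (HJi N HN).
      have [b Db [b0 Dbe]] := Dfrac (z / e).
      have [s [t [r [Ms Nt Dr st]]]] := separated HM HN MN Db b0.
      have t0 := prime_compl_neq0 Dring pN Nt.
      exists s => //.
      have -> : s * z = (b * (z / e) * r * t^-1) * e.
        have -> : b * (z / e) * r * t^-1 * e = z * (b * r) * (e / e) * t^-1 by ring.
        by rewrite -st divff // mulr1 mulrA mulfK // mulrC.
      apply: (ideal_mul (HJi N HN)) => //.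
      apply: (subringM (loc_subring Dring pN)); last exact: (loc_inv Dring pN).
      by apply: (sub_loc Dring pN); apply: (subringM Dring).
  (* [s] settles the [N] in [X]. At the others [d] is a unit, and [s' d z] in [D] gives [s' s z] in
     [D_N = J N]. *)
  have /(locP Dring pM)[s' Ms' Ds'] := Hd M z HM Jz.
  have [Ds _] := Ms; have [Ds'' _] := Ms'.
  exists (s' * s); first exact: (prime_complM Dring pM).
  move=> N HN; have [XN|nXN] := pselect (X N).
    by rewrite -mulrA; apply: HJm => //; apply: Hs.
  have [Nd ->] := JX N HN nXN; apply/(locP Dring (Mprime HN)); exists d => //.
  have -> : d * (s' * s * z) = s * (s' * (d * z)) by ring.
  exact: (subringM Dring).
exists J0 => //.
apply/(star_eqP HI (ideal_iprod Dring (ideal_iprod Dring HI HI) HJ0)) => M HM.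
rewrite !(iprod_locM Dring (Mprime HM)) J0E //.
by case: (HJ M HM).
Qed.

End StarRegularity.

(** Induction on the number of generators: [1 - h ord0] being invertible in [L], the first relation
    expresses [g ord0] through the others, and substituting it keeps all coefficients in [Q]. *)
Lemma nakayama (K : fieldType) (L Q : set K) n (g : 'I_n -> K) :
  (forall x y, Q x -> Q y -> Q (x + y)) ->
  (forall r x, L r -> Q x -> Q (r * x)) -> Q `<=` L ->
  (forall h, Q h -> 1 - h != 0 /\ L (1 - h)^-1) ->
  (forall i, exists2 h : 'I_n -> K, forall j, Q (h j) &
     g i = \sum_(j < n) h j * g j) ->
  forall i, g i = 0.
Proof.
move=> QD QM QL Qu; elim: n g => [g _ []//|n IH g gE].
have [h Qh g0E] := gE ord0; rewrite big_ord_recl /= in g0E.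
have [u0 Lu] := Qu _ (Qh ord0); set u := (1 - h ord0)^-1 in Lu.
have {}g0E : g ord0 = \sum_(j < n) u * h (lift ord0 j) * g (lift ord0 j).
  rewrite -[LHS](mulKf u0) -/u mulrBl mul1r {1}g0E addrC addKr mulr_sumr.
  by apply: eq_bigr => j _; rewrite mulrA.
have gS : forall i, g (lift ord0 i) = 0.
  apply: IH => i; have [k Qk ->] := gE (lift ord0 i).
  exists (fun j => k ord0 * (u * h (lift ord0 j)) + k (lift ord0 j)).
    by move=> j; apply: (QD) => //; apply: (QM); [exact: QL|exact: QM].
  rewrite big_ord_recl g0E mulr_sumr -big_split /=.
  by apply: eq_bigr => j _; rewrite mulrDl mulrA.
move=> i; case: (unliftP ord0 i) => [j ->//|->].
by rewrite g0E big1 // => j _; rewrite gS mulr0.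
Qed.

(** * The v-, t- and w-operations *)

Section DivisorialClosure.
Variables (K : fieldType) (D : set K).
Hypothesis Dring : subring D.
Implicit Types (I J P : set K) (x y z : K).

Lemma v_op_min I J : I `<=` v_op D J -> v_op D I `<=` v_op D J.
Proof.
by move=> IJ z Iz y Jy; apply: Iz => x /IJ Jx; rewrite mulrC; apply: Jx.
Qed.

Lemma sub_v_op I : I `<=` v_op D I.
Proof. by move=> x Ix y; rewrite mulrC; apply. Qed.

Lemma v_opS I J : I `<=` J -> v_op D I `<=` v_op D J.
Proof. by move=> IJ; apply: v_op_min; apply: subset_trans (@sub_v_op J). Qed.

Lemma v_op_sub I : I `<=` D -> v_op D I `<=` D.
Proof.
by move=> ID z Iz; rewrite -(mulr1 z); apply: Iz => x /ID; rewrite mul1r.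
Qed.

Lemma v_opD I x y : v_op D I x -> v_op D I y -> v_op D I (x + y).
Proof.
by move=> Ix Iy z Hz; rewrite mulrDl; apply: (subringD Dring); [exact: Ix|exact: Iy].
Qed.

Lemma v_opM I r x : D r -> v_op D I x -> v_op D I (r * x).
Proof. by move=> Dr Ix z Hz; rewrite -mulrA; apply: (subringM Dring) => //; apply: Ix. Qed.

(** The lists of generators are concatenated; one entry is nonzero because [J] is, and [P] bounds
    the denominators. *)
Lemma fg_ideal_adjoin_finite J P n (m : 'I_n -> K) :
  ideal D P -> fg_ideal D J -> J `<=` P -> (forall i, P (m i)) ->
  exists J', [/\ fg_ideal D J', J `<=` J', J' `<=` P & forall i, J' (m i)].
Proof.
move=> HP [HJ [k [g Jg]]] JP Pm.
pose f (i : 'I_(k + n)) := match fintype.split i with inl j => g j | inr j => m j end.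
have fl i : f (lshift n i) = g i by rewrite /f (unsplitK (inl i)).
have fr i : f (rshift k i) = m i by rewrite /f (unsplitK (inr i)).
have Pg i : P (g i) by apply: JP; rewrite Jg; apply: span_gen.
have Pf i : P (f i) by rewrite /f; case: fintype.split.
have JS : J `<=` span D f.
  rewrite Jg => _ [r Dr ->].
  exists (fun i => match fintype.split i with inl j => r j | inr j => 0 end).
    by move=> i; case: fintype.split => // _; apply: (subring0 Dring).
  rewrite big_split_ord /= [X in _ + X]big1 ?addr0.
    by apply: eq_bigr => i _; rewrite (unsplitK (inl i)) fl.
  by move=> i _; rewrite (unsplitK (inr i)) mul0r.
exists (span D f); split=> //.
- split; last by exists (k + n)%N, f.
  have [i fi0] : exists i, f i != 0.
    have [x /JS[r Dr xE] x0] := ideal_neq0 HJ.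
    apply: contrapT => nf; case/eqP: x0; rewrite xE big1 // => i _.
    suff -> : f i = 0 by rewrite mulr0.
    by apply/eqP; apply: contrapT => fi; apply: nf; exists i; apply/negP.
  exact: (span_ideal Dring HP Pf fi0).
- exact: (span_min Dring HP Pf).
- by move=> i; rewrite -fr; apply: span_gen.
Qed.

(* If [1] is in the [v]-closure of [J], the colon ideal of [A = J D_P] is
   contained in [D_P]; writing [A = A A B], the factor [A B] then lies in
   [A], hence in the maximal ideal, and Nakayama gives [A = 0]. *)
Lemma clifford_regular_v_op P J : prime_ideal D P ->
  clifford_regular (loc D P) -> fg_ideal D J -> J `<=` P -> ~ v_op D J 1.
Proof.
move=> pP Hcl [HJ [n [g Jg]]] JP J1.
have HP := prime_idealI pP; have Lring := loc_subring Dring pP.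
have Jgen i : J (g i) by rewrite Jg; apply: span_gen.
have CD z : colon D J z -> D z by move=> /J1; rewrite mul1r.
set L := loc D P in Hcl Lring; set A := J ** L.
have HA : ideal L A by apply: (ideal_loc Dring pP HJ).
have JA : J `<=` A.
  by move=> x Jx; rewrite -(mulr1 x); apply: iprod_in => //; apply: (subring1 Lring).
have AP : A `<=` P ** L by apply: iprodS.
have PL : P ** L `<=` L.
  rewrite -[X in _ `<=` X](iprod_locT Dring pP); apply: iprodS => //.
  exact: (prime_sub pP).
have AL : A `<=` L by apply: subset_trans PL.
(* [J] has finitely many generators, so one [s] outside [P] takes [z] into [(D : J)], which lies in
   [D] because 1 is in the v-closure of [J]. *)
have CL z : colon L A z -> L z.
  move=> Az.
  have [s Ps Hs] : exists2 s, (D `\` P) s &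
      forall i : 'I_n, [set: 'I_n] i -> D (s * (z * g i)).
    apply: (finite_simultaneous (D := D) (L := fun i s => D (s * (z * g i)))).
    - exact: finite_finset.
    - exact: (prime_compl1 Dring pP).
    - by move=> u v; apply: (prime_complM Dring pP).
    - by move=> u [].
    - by move=> i r u _ Dr Du; rewrite -mulrA; apply: (subringM Dring).
    - by move=> i _; have /(locP Dring pP)[s Ps Ds] := Az _ (JA _ (Jgen i)); exists s.
  apply/(locP Dring pP); exists s => //; apply: CD; rewrite Jg => _ [r Dr ->].
  rewrite mulr_sumr; apply: (ideal_sum Dring (idealT Dring)) => i.
  rewrite mulrCA; apply: (subringM Dring) => //.
  by rewrite -mulrA; apply: Hs.
have [B HB AE] := Hcl A HA.
(* [(A B) A = A] lies in [L], so [A B] lies in [(L : A)], hence in [L]. The same argument then puts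
   [B] in [L], and so [A B] in [A]. *)
have ABL : A ** B `<=` L.
  move=> h ABh; apply: CL => a Aa; apply: AL; rewrite AE iprodCA.
  exact: iprod_in.
have BL : B `<=` L.
  by move=> b Bb; apply: CL => a Aa; apply: ABL; rewrite mulrC; apply: iprod_in.
have ABQ : A ** B `<=` P ** L.
  apply: subset_trans AP; rewrite -[X in _ `<=` X](iprod_idr Lring HA).
  exact: iprodS.
have HQ : ideal L (P ** L) by apply: (ideal_loc Dring pP HP).
have g0 : forall i, g i = 0.
  apply: (@nakayama K L (P ** L)) => //.
  - by move=> x y; apply: (ideal_add HQ).
  - by move=> r x; apply: (ideal_mul HQ).
  (* With [s] outside [P] and [s h] in [P], [s (1 - h)] stays outside [P], so [1 - h] is a unit of
     [L]. *)
  - move=> h /(ideal_locP Dring pP _ HP)[s [Ds Ps] Psh].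
    have Pc : (D `\` P) (s * (1 - h)).
      rewrite mulrBr mulr1; split.
        by apply: (subringB Dring) => //; apply: (prime_sub pP).
      move=> Pd; apply: Ps; rewrite -(subrK (s * h) s).
      exact: (ideal_add HP).
    have := prime_compl_neq0 Dring pP Pc; rewrite mulf_eq0 negb_or => /andP[s0 h0].
    split=> //; have -> : (1 - h)^-1 = s * (s * (1 - h))^-1.
      by rewrite invfM mulVKf.
    apply: (subringM Lring); first exact: (sub_loc Dring pP).
    exact: (loc_inv Dring pP).
  - move=> i; have : A (g i) by apply: JA.
    rewrite AE -iprodA; move: (g i).
    suff : A ** (A ** B) `<=` [set z | exists2 h : 'I_n -> K,
      forall j, (P ** L) (h j) & z = \sum_(j < n) h j * g j] by [].
    apply: iprod_min.
    + exists (fun=> 0) => [_|]; first exact: iprod0.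
      by rewrite big1 // => j _; rewrite mul0r.
    + move=> x y [h Qh ->] [k Qk ->]; exists (fun j => h j + k j).
        by move=> j; apply: (ideal_add HQ).
      by rewrite -big_split /=; apply: eq_bigr => j _; rewrite mulrDl.
    + move=> a h /(ideal_locP Dring pP _ HJ)[s Ps]; rewrite Jg => -[r Dr saE] /ABQ Qh.
      exists (fun j => s^-1 * r j * h) => [j|].
        apply: (ideal_mul HQ) => //; apply: (subringM Lring).
          exact: (loc_inv Dring pP).
        exact: (sub_loc Dring pP).
      rewrite -(mulKf (prime_compl_neq0 Dring pP Ps) a) saE mulr_sumr mulr_suml.
      by apply: eq_bigr => j _; ring.
have [x] := ideal_neq0 HJ; rewrite Jg => -[r Dr ->]; rewrite big1 ?eqxx // => i _.
by rewrite g0 mulr0.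
Qed.

End DivisorialClosure.

(** * Equality of the star-maximal and the t-maximal ideals *)

Section TildeW.
Variables (K : fieldType) (D : set K).
Hypothesis Dring : subring D.
Hypothesis Dfrac : forall z : K, exists2 d, D d & d != 0 /\ D (d * z).
Variable star : set K -> set K.
Hypothesis Hstar : star_operation D star.
Hypothesis Hfin : finite_type D star.
Implicit Types (I J M N : set K) (x y z : K).

(** Each [y] in [(D : I)] carries [I] into [D], hence [star I] into [star D = D]. *)
Lemma star_sub_v_op I : ideal D I -> star I `<=` v_op D I.
Proof.
move=> HI x Ix y Hy; rewrite mulrC.
apply: (star_ideal_mulr Dring Dfrac Hstar HI _ Hy Ix).
by split; [exact: idealT|rewrite (star_unit Hstar)].
Qed.

Lemma star_sub_t_op I : ideal D I -> star I `<=` t_op D I.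
Proof.
move=> HI x; rewrite Hfin // => -[J [HJ JI] Jx]; exists J => //.
exact: (star_sub_v_op HJ.1).
Qed.

Lemma t_proper_star_proper I : proper_integral_star_ideal D (t_op D) I ->
  proper_integral_star_ideal D star I.
Proof.
move=> [[HI IE] ID nID]; split=> //; split=> //; apply/seteqP; split.
  exact: (star_sub Hstar).
by rewrite [X in _ `<=` X]IE; apply: star_sub_t_op.
Qed.

Hypothesis Hloc : forall M, star_Max D star M -> clifford_regular (loc D M).

(** Let [x] outside [M] be in the v-closure of a finitely generated [J] inside [M]. By maximality
    and finite type, some finitely generated [J1] inside [M + D x] has 1 in its closure. Adding to
    [J] the [M]-parts of the generators of [J1] gives [J2] inside [M] whose v-closure contains [J1],
    hence 1, against [clifford_regular_v_op]. *)
Lemma t_op_star_Max M : star_Max D star M -> t_op D M = M.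
Proof.
move=> HM; have pM := star_Max_prime Dring Dfrac Hstar HM.
have HMi := prime_idealI pM; have MD := prime_sub pM.
have [[[_ ME] _ _] Mmax] := HM.
apply/seteqP; split; last by rewrite [X in X `<=` _]ME; apply: star_sub_t_op.
move=> x [J [HJ JM] Jx]; apply: contrapT => nMx.
have Dx : D x by apply: v_op_sub Jx; apply: subset_trans MD.
have HMx : ideal D (adjoin D M x) by apply: ideal_adjoin.
have MxD : adjoin D M x `<=` D.
  move=> _ [y [r [My Dr ->]]]; apply: (subringD Dring); first exact: MD.
  exact: (subringM Dring).
have : star (adjoin D M x) 1.
  apply: contrapT => n1; apply: nMx; rewrite -(Mmax (star (adjoin D M x))).
  - exact: (star_sub Hstar HMx (mem_adjoinr Dring x HMi)).
  - split; [split| |].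
    + exact: (star_ideal_val Hstar).
    + by rewrite (star_idem Hstar).
    + exact: (star_sub_unit Dring Hstar).
    + by move=> sD; apply: n1; rewrite sD; apply: (subring1 Dring).
  - apply: subset_trans (star_sub Hstar HMx); exact: (mem_adjoinl Dring).
rewrite Hfin // => -[J1 [[HJ1 [n [g Jg]]] J1M] /(star_sub_v_op HJ1) v1].
have /choice[m Hm] : forall i, exists y, M y /\ exists2 r, D r & g i = y + r * x.
  move=> i; have : J1 (g i) by rewrite Jg; apply: span_gen.
  by move=> /J1M[y [r [My Dr ->]]]; exists y; split=> //; exists r.
have [|J2 [HJ2 JJ2 J2M J2m]] := @fg_ideal_adjoin_finite _ _ Dring _ _ _ m HMi HJ JM.
  by move=> i; case: (Hm i).
apply: (clifford_regular_v_op Dring pM (Hloc HM) HJ2 J2M).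
apply: v_op_min v1; rewrite Jg => _ [a Da ->].
apply: (big_ind (v_op D J2)).
- by move=> z _; rewrite mul0r; apply: (subring0 Dring).
- exact: v_opD.
- move=> i _; apply: v_opM => //; have [_ [r Dr ->]] := Hm i.
  apply: v_opD => //; first exact: sub_v_op.
  by apply: v_opM => //; apply: v_opS Jx.
Qed.

(** A t-maximal ideal is a proper star-ideal, so it lies in a star-maximal one; this is a t-ideal,
    so the two coincide. Conversely a t-ideal containing a star-maximal [M] is a star-ideal. *)
Lemma star_Max_t_op : star_Max D (t_op D) = star_Max D star.
Proof.
have sub M : star_Max D star M -> proper_integral_star_ideal D (t_op D) M.
  by move=> HM; have [[[HMi _] MD nMD] _] := HM; split=> //; split=> //; rewrite t_op_star_Max.
apply/seteqP; split=> [N [HN Nmax]|M HM].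
  have [M HM NM] := star_Max_exists Dring Hstar Hfin (t_proper_star_proper HN).
  by rewrite -(Nmax _ (sub M HM) NM).
split; first exact: sub.
by move=> I /t_proper_star_proper; apply: HM.2.
Qed.

Lemma star_tilde_w_op I : star_tilde D star I = w_op D I.
Proof. by rewrite /w_op /star_tilde star_Max_t_op. Qed.

End TildeW.

(** * A domain inside its field of fractions *)

Lemma frac_image_subring (R : idomainType) : subring (frac_image R).
Proof.
split; first by exists 1; rewrite ?rmorph1.
- by move=> _ _ [x _ <-] [y _ <-]; exists (x - y); rewrite ?rmorphB.
- by move=> _ _ [x _ <-] [y _ <-]; exists (x * y); rewrite ?rmorphM.
Qed.

Lemma frac_image_denom (R : idomainType) (z : {fraction R}) :
  exists2 d, frac_image R d & d != 0 /\ frac_image R (d * z).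
Proof.
elim/quotW: z => x; exists (tofrac \d_x); first by exists \d_x.
split; first by rewrite tofrac_eq0 denom_ratioP.
exists \n_x => //; unlock FracField.tofrac.
rewrite -[RHS]FracField.pi_mul; apply/eqmodP; rewrite /= FracField.equivfE.
by rewrite /FracField.mulf !numden_Ratio ?mul1r ?mulr1 ?oner_neq0 ?denom_ratioP // mulrC.
Qed.

Theorem theorem5p6 (R : idomainType)
    (star : set {fraction R} -> set {fraction R}) :
  let D := frac_image R in
  star_operation D star ->
  finite_type D star ->
  spectral D star ->
  (forall I, ideal D I -> star I = star_tilde D star I) ->
  (forall P, star_prime D star P ->
     exists! M, star_Max D star M /\ P `<=` M) ->
  let cond_i := clifford_star_regular D star in
  let cond_ii :=
    (forall M, star_Max D star M -> clifford_regular (loc D M)) /\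
    star_finite_character D star in
  let cond_iii :=
    (forall M, star_Max D star M -> clifford_regular (loc D M)) /\
    star_local_star_invertibility D star in
  [/\ cond_i <-> cond_ii,
      cond_i <-> cond_iii &
      cond_i \/ cond_ii \/ cond_iii ->
      forall I, ideal D I -> star_tilde D star I = w_op D I].
Proof.
move=> D Hstar Hfin _ Htilde Huniq cond_i cond_ii cond_iii.
have Dring : subring D := frac_image_subring R.
have Dfrac := @frac_image_denom R.
have i_iii : cond_i -> cond_iii.
  move=> Hi; split; first exact: (clifford_star_regular_loc Dring Dfrac Hstar).
  exact: (clifford_star_local_invertibility Dring Dfrac Hstar Htilde Hi).
have iii_ii : cond_iii -> cond_ii.
  move=> [Hloc Hinv]; split=> //.
  exact: (star_local_invertibility_finite_character
    Dring Dfrac Hstar Hfin Htilde Huniq Hinv).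
have ii_i : cond_ii -> cond_i.
  move=> [Hloc Hfc].
  exact: (finite_character_clifford Dring Dfrac Hstar Hfin Htilde Huniq Hloc Hfc).
split; [by split=> [/i_iii/iii_ii|/ii_i]|by split=> [/i_iii|/iii_ii/ii_i]|].
(* Local Clifford regularity remains to be shown, and each of the three conditions provides it. *)
move=> H I _; apply: (star_tilde_w_op Dring Dfrac Hstar Hfin).
by case: H => [/i_iii[]|[[]|[]]].
Qed.
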